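(* Let $X$ be a topological space that has a countable locally uniform $\overline{\mathsf{cs}}^{**}$-netbase, and let $x\in X$. Then $X$ is first-countable at $x$ if and only if $X$ is a $q$-space at $x$.
   Context: An entourage on $X$ is a subset $E\subset X\times X$ containing the diagonal; $E[x]=\{y:(x,y)\in E\}$, $E^{-1}=\{(y,x):(x,y)\in E\}$, $UV=\{(x,z):\exists y\ (x,y)\in U,\ (y,z)\in V\}$. An entourage base for a topological space $X$ is a family $\mathcal B$ of entourages such that (i) for all $B_1,B_2\in\mathcal B$ there is $B_3\in\mathcal B$ with $B_3\subset B_1\cap B_2$; (ii) for every $x\in X$ the family $\{B[x]:B\in\mathcal B\}$ is a neighborhood base at $x$ (neighborhoods need not be open). It is locally uniform if for every $x\in X$ and neighborhood $O_x$ of $x$ there is $B\in\mathcal B$ with $BB^{-1}B[x]\subset O_x$. A set $C\subset X$ accumulates at $x$ if every neighborhood of $x$ contains infinitely many points of $C$. A sequence $(x_n)$ accumulates at $x$ if each neighborhood of $x$ contains $x_n$ for infinitely many $n$. A closed set is countably compact if each of its infinite subsets accumulates at some point. $\overline{\mathsf{cs}}$ is the family of all countable subsets of $X$ whose closure in $X$ is countably compact. For a family $\mathcal C$ of subsets of $X$, a $\mathcal C^{**}$-netbase for $X$ is a pair $(\mathcal E,\mathcal B)$ where $\mathcal E$ is a family of entourages on $X$ and $\mathcal B$ is an entourage base for $X$ such that for any $B\in\mathcal B$ and any $C\in\mathcal C$ accumulating at some point of $X$ there are $E\in\mathcal E$ with $E\subset B$ and a point $z\in X$ such that $E[z]\cap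 C$ is infinite. It is countable if $\mathcal E$ is countable and locally uniform if $\mathcal B$ is locally uniform. $X$ is a $q$-space at $x$ if there is a sequence $(U_n)_{n\in\omega}$ of neighborhoods of $x$ such that every sequence $(x_n)_{n\in\omega}\in\prod_{n\in\omega}U_n$ accumulates at some point of $X$. *)

(* Defs.v *)
From mathcomp Require Import all_boot.
From mathcomp Require Import boolp classical_sets functions cardinality filter.
From mathcomp Require Import topology.

Set Implicit Arguments.
Unset Strict Implicit.
Unset Printing Implicit Defensive.

Local Open Scope classical_set_scope.

Definition accum_at (X : topologicalType) (C : set X) (x : X) : Prop :=
  forall U, nbhs x U -> infinite_set (U `&` C).

Definition seq_accum_at (X : topologicalType) (u : nat -> X) (x : X) :
    Prop :=
  forall U, nbhs x U -> infinite_set [set n | U (u n)].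

Definition countably_compact (X : topologicalType) (A : set X) : Prop :=
  closed A /\
  forall I, I `<=` A -> infinite_set I -> exists x, accum_at I x.

(* "Countable" includes finite, here and below. *)
Definition cs_bar (X : topologicalType) : set (set X) :=
  [set C | countable C /\ countably_compact (closure C)].

(* The members of a neighborhood base need not be open. *)
Definition nbhs_base (X : topologicalType) (x : X) (S : set (set X)) : Prop :=
  S `<=` nbhs x /\ forall U, nbhs x U -> exists2 V, S V & V `<=` U.

Definition first_countable_at (X : topologicalType) (x : X) : Prop :=
  exists2 S, countable S & nbhs_base x S.

Definition q_space_at (X : topologicalType) (x : X) : Prop :=
  exists2 U : nat -> set X, (forall n, nbhs x (U n)) &
    forall u : nat -> X, (forall n, U n (u n)) ->
      exists y, seq_accum_at u y.

(* A bare reflexive relation, as opposed to the entourages of a uniformType;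
   E[x] is [xsection E x]. *)
Definition is_entourage (X : Type) (E : set (X * X)) : Prop := diagonal `<=` E.

Definition entourage_base (X : topologicalType) (Bs : set (set (X * X))) :
    Prop :=
  [/\ Bs `<=` @is_entourage X,
      forall B1 B2, Bs B1 -> Bs B2 -> exists2 B3, Bs B3 & B3 `<=` B1 `&` B2 &
      forall x, nbhs_base x [set xsection B x | B in Bs]].

(* The library's [\;] composes from right to left; the order is immaterial for
   the palindrome B B^-1 B. *)
Definition locally_uniform (X : topologicalType) (Bs : set (set (X * X))) :
    Prop :=
  forall (x : X) (O : set X), nbhs x O ->
    exists2 B, Bs B & xsection (B \; B^-1 \; B)%relation x `<=` O.

(* (Es, Bs) is a C**-netbase for the family Cs. *)
Definition netbase (X : topologicalType) (Cs : set (set X))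
    (Es Bs : set (set (X * X))) : Prop :=
  [/\ Es `<=` @is_entourage X,
      entourage_base Bs &
      forall B C, Bs B -> Cs C -> (exists x, accum_at C x) ->
        exists E z, [/\ Es E, E `<=` B & infinite_set (xsection E z `&` C)]].

Definition has_countable_locally_uniform_netbase (X : topologicalType)
    (Cs : set (set X)) : Prop :=
  exists Es Bs, [/\ netbase Cs Es Bs, countable Es & locally_uniform Bs].

(* Main.v *)
Require Import Defs.
From mathcomp Require Import all_boot.
From mathcomp Require Import boolp classical_sets functions cardinality filter.
From mathcomp Require Import topology.

(** First-countability at [x] gives the q-property by intersecting initial
    segments of a countable base: any sequence chosen in the resulting sets
    converges to [x].

    For the converse, local uniformity makes [X] regular, so the
    neighborhoods witnessing the q-property can be shrunk to a sequence [V]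
    with [closure (V n.+1) `<=` V n]. Then every sequence [u] with [u n] in
    [V n] has a range whose closure is countably compact
    ([q_sequence_countably_compact]), so the netbase applies to that range as
    soon as [u] is injective. It provides, for each base entourage [B], some
    [E `<=` B] in [Es] such that infinitely many [u n] share a ball [E[z]];
    in other words, two terms of [u] of arbitrarily large index are linked by
    [E] ([netbase_linked_q_sequence]).

    Hence one cannot choose [u n] in [V n] inductively so as to avoid, at step
    [n], every point linked to an earlier term by one of the first [n]
    entourages of [Es] contained in [B]. The choice gets stuck, and some [V n]
    is covered by finitely many sets [linked E d] with [E `<=` B]. Since the
    choices depend only on finite initial segments of the list of entourages,
    all the points [d] that occur, for all [B], form a single countable set
    ([escape_dichotomy]). From [V n] one then removes those sets [linked E d]
    of the finite cover to whose closure [x] does not belong. What is left is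
    a neighborhood of [x], taken from a countable family that does not depend
    on [B], and its points are joined to [x] by zigzags of five steps in [B].
    Local uniformity makes it as small as desired
    ([locally_uniform_linked]). *)

Set Implicit Arguments.
Unset Strict Implicit.
Unset Printing Implicit Defensive.

Local Open Scope classical_set_scope.

(** * Sequences that escape given sets *)

Lemma infinite_nat_unbounded (A : set nat) (N : nat) :
  infinite_set A -> exists2 n, N <= n & A n.
Proof.
move=> /infinite_setD /(_ (finite_II N)) /infinite_setN0[n [An /negP]].
by rewrite -leqNgt => Nn; exists n.
Qed.

(** The list is ordered from the last point chosen to the first. The point
    added at [i :: s'] depends on [s'] only: the [n]-th choice has to avoid the
    sets indexed by the [n] previous indices, and depends on nothing else. *)
Fixpoint escape_points (X : choiceType) (x0 : X) (V : nat -> set X)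
    (T : nat -> X -> set X) (s : seq nat) : seq X :=
  if s is _ :: s' then
    let l := escape_points x0 V T s' in
    xget x0 (V (size s') `\` \bigcup_(p in [set` s'] `*` [set` l]) T p.1 p.2)
      :: l
  else [::].

(** Either a term [u n] of [V n] avoiding the sets [T (h i) (u j)] with
    [i, j < n] can be chosen at every step, or the construction stops because
    finitely many such sets cover some [V n]. The points are indexed by finite
    sequences of natural numbers, that is by a tree of partial constructions,
    and this is why one countable [D] serves the uncountably many [h]. *)
Lemma escape_dichotomy (X : choiceType) (x0 : X) (V : nat -> set X)
    (T : nat -> X -> set X) :
  exists2 D : set X, countable D & forall h : nat -> nat,
    (exists n (P : set (nat * X)), [/\ finite_set P, P `<=` range h `*` D &
       V n `<=` \bigcup_(p in P) T p.1 p.2]) \/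
    (exists u : nat -> X, forall n, V n (u n) /\
       forall i j, i < n -> j < n -> ~ T (h i) (u j) (u n)).
Proof.
pose pts := escape_points x0 V T.
(* The leading 0 is a dummy index: the head of the list for [i :: s] does not
   depend on [i]. *)
pose point s := head x0 (pts (0 :: s)).
exists (range point).
  by apply: (sub_countable (card_image_le _ _)); apply: countableP.
move=> h.
pose hist n := rev (mkseq h n).
have histS n : hist n.+1 = h n :: hist n.
  by rewrite /hist /mkseq -addn1 iotaD map_cat rev_cat.
have histE n i : i \in hist n -> exists2 k, k < n & i = h k.
  by rewrite mem_rev => /mapP[k]; rewrite mem_iota => /andP[_ kn] ->; exists k.
have mem_hist n k : k < n -> h k \in hist n.
  by move=> kn; rewrite mem_rev map_f// mem_iota.
have size_hist n : size (hist n) = n by rewrite size_rev size_mkseq.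
pose u n := point (hist n).
have ptsE n d : d \in pts (hist n) -> exists2 k, k < n & d = u k.
  elim: n => // n IH; rewrite histS inE => /predU1P[->|/IH[k kn ->]].
    by exists n.
  by exists k => //; exact: leqW.
have mem_pts n k : k < n -> u k \in pts (hist n).
  elim: n => // n IH; rewrite ltnS leq_eqVlt histS inE.
  by case/predU1P=> [->|/IH ->]; rewrite ?eqxx ?orbT.
have [esc|] := pselect (forall n, V n `\`
    \bigcup_(p in [set` hist n] `*` [set` pts (hist n)]) T p.1 p.2 !=set0).
  right; exists u => n.
  have [] : (V n `\` \bigcup_(p in [set` hist n] `*` [set` pts (hist n)])
      T p.1 p.2) (u n) by have := xgetPex x0 (esc n); rewrite /u /point /= size_hist.
  move=> Vn Tn; split=> // i j iltn jltn Tu.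
  by apply: Tn; exists (h i, u j) => //; split; [exact: mem_hist|exact: mem_pts].
move=> /existsNP[n /nonemptyPn esc]; left.
exists n, ([set` hist n] `*` [set` pts (hist n)]); split.
- by apply: finite_setX; exact: finite_seq.
- move=> [i d] [/= /histE[k _ ->] /ptsE[m _ ->]].
  by split; [exists k|exists (hist m)].
- by apply: contrapT => /existsNP[y /not_implyP Vy]; have : set0 y by rewrite -esc.
Qed.

(** An instance of the dichotomy where the sets to avoid are the singletons of
    the earlier terms: finitely many of them never cover an infinite set. *)
Lemma injective_selection (X : choiceType) (A : nat -> set X) :
  (forall n, infinite_set (A n)) ->
  exists2 u : nat -> X, injective u & forall n, A n (u n).
Proof.
move=> Ainf; have [x0 _] := infinite_setN0 (Ainf 0).
have [D _ /(_ id)[[n [P [finP _ AP]]]|[u uP]]] :=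
    escape_dichotomy x0 A (fun _ d => [set d]).
  case: (Ainf n); apply: (sub_finite_set AP).
  by apply: bigcup_finite => // p _; exact: finite_set1.
exists u => [m n umn|n]; last by have [] := uP n.
apply: contrapT => /eqP; rewrite neq_ltn => /orP[] lt; last move/esym: umn => umn.
  by have [_ /(_ m m lt lt)] := uP n; apply.
by have [_ /(_ n n lt lt)] := uP m; apply.
Qed.

(** * Accumulation and countable neighborhood bases *)

Section Topology.
Context {X : topologicalType}.
Implicit Types (x y : X) (u : nat -> X) (V : nat -> set X).

Lemma accum_at_range u x :
  injective u -> seq_accum_at u x -> accum_at (range u) x.
Proof.
move=> injU ux U /ux infU finU; apply: infU.
have -> : [set n | U (u n)] = u @^-1` (U `&` range u).
  by apply/seteqP; split=> [n Un|n []//]; split=> //; exists n.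
by apply: finite_preimage => // m n _ _; exact: injU.
Qed.

Lemma accum_atS (A B : set X) x : A `<=` B -> accum_at A x -> accum_at B x.
Proof.
by move=> AB Ax U /Ax; apply: sub_infinite_set; exact: setIS.
Qed.

Lemma nbhs_bigcap_finite (I : choiceType) (D : set I) (F : I -> set X) x :
  finite_set D -> (forall i, D i -> nbhs x (F i)) ->
  nbhs x (\bigcap_(i in D) F i).
Proof.
move=> /finite_fsetP[D' ->] DF.
by apply: filter_bigI => i iD'; exact: DF.
Qed.

(** If [g] enumerates a countable base at [x], a sequence with [u n] in each
    of [g 0], ..., [g n] is eventually in every neighborhood of [x]. *)
Lemma first_countable_at_q_space_at x :
  first_countable_at x -> q_space_at x.
Proof.
move=> [S /pfcard_geP[S0|[g]] [Snbhs Sbase]].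
  by have [A] := Sbase _ (@filterT _ (nbhs x) _); rewrite S0.
have gS k : S (g k) by exact: (@funS _ _ _ _ g).
exists (fun n => \bigcap_(k in `I_n.+1) g k) => [n|u uU].
  by apply: nbhs_bigcap_finite => // k _; exact/Snbhs/gS.
exists x => U /Sbase[_ /(@surj _ _ _ _ g)[k _ <-] gU].
apply: sub_infinite_set (infinite_setD infinite_nat (finite_II k)).
by move=> n [_ /negP]; rewrite -leqNgt => kn; apply/gU/uU.
Qed.

(** * Regularity *)

(** This is the section at [d] of the symmetric relation induced by [E]: two
    points are linked by [E] when they lie in a common ball [E[z]]. *)
Definition linked (E : set (X * X)) (d : X) : set X :=
  [set y | exists2 z, E (z, d) & E (z, y)].

Lemma xsection_zigzag (B : set (X * X)) x y w z :
  B (x, w) -> B (z, w) -> B (z, y) -> xsection (B \; B^-1 \; B)%relation x y.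
Proof. by move=> Bxw Bzw Bzy; apply/xsectionP; exists z => //; exists w. Qed.

Lemma entourage_base_nbhs (Bs : set (set (X * X))) B x :
  entourage_base Bs -> Bs B -> nbhs x (xsection B x).
Proof. by move=> [_ _ /(_ x)[sub _]] BsB; apply: sub; exists B. Qed.

(** If [y] is in the closure of [B[x]], then [B[y]] meets [B[x]], and the steps
    from [x] to the common point, back to [y], and from [y] to itself form a
    zigzag of length three. *)
Lemma locally_uniform_regular (Bs : set (set (X * X))) :
  entourage_base Bs -> locally_uniform Bs -> regular_space X.
Proof.
move=> base lu x O /lu[B BsB BO]; have [refl _ _] := base.
exists (xsection B x); first exact: entourage_base_nbhs base BsB.
move=> y /(_ _ (entourage_base_nbhs y base BsB))[w [/xsectionP Bxw /xsectionP Byw]].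
by apply/BO/(xsection_zigzag Bxw Byw)/(refl B).
Qed.

(** Local uniformity controls zigzags of length three, and applying it twice
    controls those of length five: three steps lead from [x] into [B1[x]], and two
    more steps then complete a zigzag of [B1] issued from [x]. *)
Lemma locally_uniform_linked (Bs : set (set (X * X))) x O :
  entourage_base Bs -> locally_uniform Bs -> nbhs x O ->
  exists2 B, Bs B & forall d, linked B d `&` xsection B x !=set0 ->
    linked B d `<=` O.
Proof.
move=> base lu /lu[B1 BsB1 B1O]; have [_ Bscap _] := base.
have [B2 BsB2 B2B1] := lu _ _ (entourage_base_nbhs x base BsB1).
have [B BsB BB12] := Bscap _ _ BsB1 BsB2; exists B => // d.
move=> [w [[z' /BB12[_ B2z'd] /BB12[_ B2z'w]] /xsectionP/BB12[_ B2xw]]] y.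
move=> [z /BB12[B1zd _] /BB12[B1zy _]].
have /B2B1/xsectionP B1xd := xsection_zigzag B2xw B2z'w B2z'd.
exact/B1O/(xsection_zigzag B1xd B1zd B1zy).
Qed.

(** * Decreasing q-sequences *)

(** The inclusions of closures ensure that a point in the closure of the range
    of a sequence chosen in the [V n] either lies in all the [V n] or is in the
    closure of finitely many terms. *)
Definition q_sequence x V := [/\ forall n, nbhs x (V n),
  forall n, closure (V n.+1) `<=` V n &
  forall u, (forall n, V n (u n)) -> exists y, seq_accum_at u y].

Lemma regular_q_sequence x : regular_space X -> q_space_at x ->
  exists V, q_sequence x V.
Proof.
move=> reg [U Unbhs Uq].
(* [r] shrinks a neighborhood of [x] to one whose closure it contains. *)
have /choice[r rP] (O : set X) : exists O', nbhs x O ->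
    nbhs x O' /\ closure O' `<=` O.
  have [/reg[O' xO' O'O]|nO] := pselect (nbhs x O); first by exists O'.
  by exists set0.
pose fix V n := if n is m.+1 then r (V m) `&` U m.+1 else U 0.
have Vnbhs n : nbhs x (V n).
  by elim: n => [|n /rP[xr _]]; [exact: Unbhs|exact: filterI].
exists V; split=> // [n|u uV].
  have [_] := rP _ (Vnbhs n); apply: subset_trans.
  by apply: closureS => y [].
by apply: Uq => -[|n]; [exact: uV 0|case: (uV n.+1)].
Qed.

Lemma q_sequence_decreasing x V m n : q_sequence x V -> m <= n -> V n `<=` V m.
Proof.
move=> [_ VS _]; elim: n => [|n IH]; first by rewrite leqn0 => /eqP ->.
rewrite leq_eqVlt => /predU1P[->//|/IH]; apply: subset_trans.
by apply: subset_trans (VS n); exact: subset_closure.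
Qed.

(** No T1 axiom is assumed, so the closure of a point may be infinite; in a
    regular space, every neighborhood of the point contains that closure. *)
Lemma regular_accum_closure1 (I : set X) x : regular_space X ->
  infinite_set (I `&` closure [set x]) -> accum_at I x.
Proof.
move=> reg infI U /reg[O xO OU]; apply: sub_infinite_set infI => y [Iy xy].
split=> //; apply/OU; apply: closureS xy => _ ->; exact: nbhs_singleton.
Qed.

(** Let [I] be an infinite subset of the closure of the range. If [I] has
    infinitely many points in each [V n], an injective sequence selected in
    these sets accumulates somewhere by the q-property. Otherwise infinitely
    many points of [I] lie outside some [V n]. There the closure of the range
    reduces to the closures of the points [u 0], ..., [u n], and one of these
    contains infinitely many points of [I]. *)
Lemma q_sequence_countably_compact x V u : regular_space X ->
  q_sequence x V -> (forall n, V n (u n)) -> cs_bar (range u).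
Proof.
move=> reg qV uV; have [_ VS Vacc] := qV.
split; first by apply: (sub_countable (card_image_le _ _)); apply: countableP.
split=> [|I IC infI]; first exact: closed_closure.
have [/injective_selection[v injv vIV]|/existsNP[n /contrapT finI]] :=
    pselect (forall n, infinite_set (I `&` V n)).
  have [y vy] := Vacc v (fun n => proj2 (vIV n)).
  exists y; apply: accum_atS (accum_at_range injv vy).
  by move=> _ [n _ <-]; case: (vIV n).
have IVn : I `\` (I `&` V n) `<=` \bigcup_(i in `I_n.+1) (I `&` closure [set u i]).
  move=> y [Iy nVy].
  suff [[i lei uiy]|/VS Vy] : (\bigcup_(i in `I_n.+1) closure [set u i] `|`
      closure (V n.+1)) y; [by exists i|by case: nVy|].
  have clR : closed (\bigcup_(i in `I_n.+1) closure [set u i] `|` closure (V n.+1)).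
    apply: closedU; last exact: closed_closure.
    by apply: closed_bigcup => [|i _]; [exact: finite_II|exact: closed_closure].
  move/closure_id: clR => ->; apply: closureS (IC _ Iy) => _ [k _ <-].
  have [kn|nk] := ltnP k n.+1.
    by left; exists k => //; exact: subset_closure.
  by right; apply/subset_closure/(q_sequence_decreasing qV nk)/uV.
apply: contrapT => nacc.
apply: (infinite_setD infI finI); apply: (sub_finite_set IVn).
apply: bigcup_finite => [|i _]; first exact: finite_II.
by apply: contrapT => /(regular_accum_closure1 reg) acc; apply: nacc; exists (u i).
Qed.

(** * Countable netbases *)

(** The set [E[z]] provided by the netbase contains infinitely many terms of
    [u], and any two of them are linked through [z]. *)
Lemma netbase_linked_q_sequence (Es Bs : set (set (X * X))) B x V u :
  netbase (@cs_bar X) Es Bs -> Bs B -> regular_space X -> q_sequence x V ->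
  injective u -> (forall n, V n (u n)) ->
  exists E, [/\ Es E, E `<=` B &
    forall N, exists m n, [/\ N <= m, m < n & linked E (u m) (u n)]].
Proof.
move=> [_ _ net] BsB reg qV inju uV.
have Cacc : exists y, accum_at (range u) y.
  by have [_ _ /(_ u uV)[y uy]] := qV; exists y; exact: accum_at_range.
have [E [z [EsE EB Einf]]] :=
  net _ _ BsB (q_sequence_countably_compact reg qV uV) Cacc.
exists E; split=> // N.
have infN : infinite_set [set n | E (z, u n)].
  move=> fin; apply: Einf; apply: sub_finite_set (finite_image u fin).
  by move=> y [/xsectionP Ez [n _ un]]; exists n; rewrite //= un.
have [m Nm Em] := infinite_nat_unbounded N infN.
have [n mn En] := infinite_nat_unbounded m.+1 infN.
by exists m, n; split=> //; exists z.
Qed.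

(** The base at [x] consists of the neighborhoods of [x] of the form [V n]
    minus finitely many sets [linked E d], with [E] among countably many
    entourages and [d] in the countable set of [escape_dichotomy]. *)
Lemma q_space_at_first_countable_at x :
  has_countable_locally_uniform_netbase (@cs_bar X) ->
  q_space_at x -> first_countable_at x.
Proof.
move=> [Es [Bs [net /countable_injP[f injf] lu]]].
have [_ base _] := net; have [Bsrefl _ _] := base.
have reg := locally_uniform_regular base lu.
move=> /(regular_q_sequence reg)[V qV]; have [Vnbhs _ _] := qV.
(* The diagonal, placed at index 0, is contained in every member of the base,
   and avoiding the points linked to [u j] by the diagonal means avoiding [u j]:
   this is what makes an escaping sequence injective. *)
pose e n := if n is m.+1 then xget diagonal [set E | Es E /\ f E = m]
  else @diagonal X.
have esurj E : Es E -> exists n, e n = E.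
  move=> EsE; exists (f E).+1; rewrite /e; case: xgetP => [F _ [EsF fF]|/(_ E)[]//].
  by apply: injf => //; exact: mem_set.
have [D cD esc] := escape_dichotomy x V (linked \o e).
pose W (q : nat * set (nat * X)) :=
  V q.1 `\` \bigcup_(p in q.2) linked (e p.1) p.2.
pose Q := [set: nat] `*` [set P | P `<=` [set: nat] `*` D /\ finite_set P].
exists (nbhs x `&` (W @` Q)).
  apply: (sub_countable (subset_card_le (@subIsetr _ _ _))).
  apply: (sub_countable (card_image_le _ _)).
  apply: countableX; first exact: countableP.
  by apply/countable_finite_subset/countableX => //; exact: countableP.
split=> [A []//|O /(locally_uniform_linked base lu)[B BsB BO]].
(* [h] enumerates the entourages contained in [B], with the diagonal in place
   of the others. *)
pose h i := if `[< e i `<=` B >] then i else 0.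
have hB i : e (h i) `<=` B.
  by rewrite /h; case: ifPn => [/asboolP//|_]; exact: Bsrefl.
have [[n [P [finP PD VP]]]|[u uP]] := esc h.
(* The sets of the cover that can be removed so that a neighborhood of [x] is
   left; every other set of the cover meets [B[x]]. *)
- pose P' := [set p | P p /\ nbhs x (~` linked (e p.1) p.2)].
  exists (W (n, P')).
    split; last first.
      exists (n, P') => //; split=> //; split; last first.
        by apply: sub_finite_set finP => p [].
      by move=> p [/PD[_ Dp] _].
    rewrite /W setDE; apply: filterI; first exact: Vnbhs.
    rewrite setC_bigcup; apply: nbhs_bigcap_finite => [|p []//].
    by apply: sub_finite_set finP => p [].
  move=> y [/= /VP[p Pp py] ny].
  have [[i _ hip] _] := PD _ Pp.
  have eB : linked (e p.1) p.2 `<=` linked B p.2.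
    by move=> w [z zd zw]; exists z; apply: (hB i); rewrite hip.
  apply: (BO p.2 _ y) (eB _ py).
  apply: contrapT => /nonemptyPn disj; apply: ny; exists p => //; split=> //.
  apply: filterS (entourage_base_nbhs x base BsB) => w Bw /eB pw.
  by have : set0 w by rewrite -disj.
(* An escaping sequence would contradict the netbase property. *)
- have uV n : V n (u n) by have [] := uP n.
  have neq m n : m < n -> u m <> u n.
    move=> mn umn.
    have [_ /(_ 0 m (leq_ltn_trans (leq0n m) mn) mn)] := uP n; apply.
    suff -> : h 0 = 0 by exists (u m).
    by rewrite /h; case: ifP.
  have inju : injective u.
    move=> m n umn; apply: contrapT => /eqP; rewrite neq_ltn.
    by move=> /orP[] /neq; apply.
  have [E [EsE EB link]] := netbase_linked_q_sequence net BsB reg qV inju uV.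
  have [k ekE] := esurj E EsE; have [m [n [km mn mnE]]] := link k.
  have [_ escn] := uP n; case: (escn k m (leq_ltn_trans km mn) mn).
  by rewrite /= /h asboolT ekE.
Qed.

End Topology.

Theorem theorem2p2 (X : topologicalType) (x : X)
    (hX : has_countable_locally_uniform_netbase (@cs_bar X)) :
  first_countable_at x <-> q_space_at x.
Proof.
split; first exact: first_countable_at_q_space_at.
exact: q_space_at_first_countable_at.
Qed.
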